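(* For a sensing problem with signal Hamiltonian $\sum_j\theta_jg_j$, jump operators $L_a$ and target $q=\boldsymbol\alpha\cdot\boldsymbol\theta$, let $\eta$ be the function estimation advantage ratio, defined by $\eta^2=\left(\sum_{i:\alpha_i\ne0}\alpha_i^2/F_{\theta_i,\mathrm{opt}}\right)F_{q,\mathrm{opt}}$, where the optimal (asymptotic) quantum Fisher informations $F_{\cdot,\mathrm{opt}}$ at sensing time $t>0$ are those defined in the context. (a) (Average.) On $m\geq1$ qubits with Hamiltonian $\sum_{i=1}^m\theta_iZ_i$, jumps $L_i=\sqrt{\gamma_i}X_i$ with $\gamma_i>0$ ($i=1,\dots,m$), and $q=\sum_{i=1}^m\theta_i$: the functional HNLS condition holds for $q$ and for every $\theta_i$, and $\eta=\sqrt m$. (b) (Difference.) On two qubits with Hamiltonian $\theta_1Z_1+\theta_2Z_2$, the single jump $L=\sqrt\gamma(Z_1+Z_2)$ with $\gamma>0$, and $q=\theta_1-\theta_2$: the functional HNLS condition holds for $q$ but fails for $\theta_1$ and for $\theta_2$, and $\eta=\sqrt{8\gamma t}$. (c) (Fourier mode.) On $m\geq3$ qubits indexed by $j\in\mathbb Z/m\mathbb Z$ with Hamiltonian $\sum_{j=0}^{m-1}\theta_jX_j$, jumps $L_j=\sqrt\gamma(\sigma_j^--\sigma_{j+1}^-)$ with $\gamma>0$ ($j=0,\dots,m-1$), and $q=\sum_{j=0}^{m-1}\cos(2\pi j/m)\theta_j$: the functional HNLS condition fails for $q$ and for every $\theta_j$, and $$\eta=\frac{1}{\sqrt2\,\sin(\pi/m)},\qquad\text{so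 that}\qquad \eta\sim\frac{m}{\sqrt2\,\pi}\quad(m\to\infty).$$
   Context: $X_i,Z_i$ are Pauli operators on qubit $i$, $\sigma_j^-=|0\rangle\langle1|$ on qubit $j$. Let $g_1,\dots,g_m$ be Hermitian operators and $\boldsymbol L=(L_1,\dots,L_r)^T$ jump operators on a finite-dimensional space, and $G(\boldsymbol\beta)=\sum_j\beta_jg_j$. The Lindblad span is $\mathcal S_L=\mathrm{span}_{\mathbb R}\{I,\,L_a^{\rm H},\,iL_a^{\rm AH},\,(L_a^\dagger L_b)^{\rm H},\,i(L_a^\dagger L_b)^{\rm AH}\}_{a,b}$ with $O^{\rm H}=(O+O^\dagger)/2$, $O^{\rm AH}=(O-O^\dagger)/2$. For nonzero $\boldsymbol\alpha\in\mathbb R^m$, the functional HNLS condition for $q=\boldsymbol\alpha\cdot\boldsymbol\theta$ is: for all $\boldsymbol v\in\mathbb R^m$, $G(\boldsymbol v)\in\mathcal S_L$ implies $\boldsymbol\alpha\cdot\boldsymbol v=0$. The optimal quantum Fisher information for $q=\boldsymbol\alpha\cdot\boldsymbol\theta$ (with all other parameter directions unknown) is, to leading order at long sensing time $t$: - if functional HNLS holds for $q$: $F_{q,\mathrm{opt}}=t^2(\zeta^* )^2$ with $\zeta^*=\min_{\boldsymbol\beta:\boldsymbol\alpha\cdot\boldsymbol\beta=1}\min_{S\in\mathcal S_L}\|G(\boldsymbol\beta)-S\|_s$, where $\|O\|_s$ is the largest minus the smallest eigenvalue of the Hermitian operator $O$; - if functional HNLS fails for $q$: $F_{q,\mathrm{opt}}=t/\Gamma^*$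 with $\frac1{\Gamma^*}=4\min\|\mathsf A_h\|$ (operator norm), the minimum being over $\boldsymbol\beta\in\mathbb R^m$ with $\boldsymbol\alpha\cdot\boldsymbol\beta=1$, $h_0\in\mathbb R$, $\mathbf h\in\mathbb C^r$ and Hermitian $\mathfrak h\in\mathbb C^{r\times r}$ satisfying $G(\boldsymbol\beta)+h_0I+\sum_a(\overline{h_a}L_a+h_aL_a^\dagger)+\sum_{a,b}\mathfrak h_{ab}L_a^\dagger L_b=0$, with $\mathsf A_h=\sum_a\left(h_aI+\sum_b\mathfrak h_{ab}L_b\right)^\dagger\left(h_aI+\sum_b\mathfrak h_{ab}L_b\right)$. $F_{\theta_i,\mathrm{opt}}$ is the same quantity with $\boldsymbol\alpha$ replaced by the $i$-th standard basis vector. *)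

(* Defs.v *)
From HB Require Import structures.
From mathcomp Require Export all_boot all_order all_algebra.
From mathcomp Require Export all_classical all_reals all_analysis.
From mathcomp Require Export complex.

Set Implicit Arguments.
Unset Strict Implicit.
Unset Printing Implicit Defensive.

Import Order.TTheory GRing.Theory Num.Theory.
Import numFieldNormedType.Exports.

Local Open Scope classical_set_scope.
Local Open Scope ring_scope.
Local Open Scope complex_scope.

Section Optimum.
Variable R : realType.
Implicit Types A : set R.

(* The attained minimum / maximum of a set of reals; the value is 0 by
   convention when there is none (in particular these are not [inf]/[sup]). *)
Definition minimum A : R := xget 0 (A `&` lbound A).
Definition maximum A : R := xget 0 (A `&` ubound A).

End Optimum.

Section Operators.
Variables (R : realType) (d : nat).
Implicit Types A : 'M[R[i]]_d.

Definition adjoint (p q : nat) (A : 'M[R[i]]_(p, q)) : 'M[R[i]]_(q, p) :=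
  (map_mx Num.conj A)^T.

Definition hpart A : 'M[R[i]]_d := 2%:R^-1 *: (A + adjoint A).
Definition ahpart A : 'M[R[i]]_d := 2%:R^-1 *: (A - adjoint A).

Definition l2norm (v : 'cV[R[i]]_d) : R :=
  Num.sqrt (\sum_k ComplexField.Normc.normc (v k 0) ^+ 2).

Definition opnorm A : R :=
  sup [set l2norm (A *m v) | v in [set v | l2norm v = 1]].

Definition real_eigenvalues A : set R := [set x | eigenvalue A x%:C].

(* Largest minus smallest eigenvalue; used for Hermitian operators only. *)
Definition spread A : R :=
  maximum (real_eigenvalues A) - minimum (real_eigenvalues A).

End Operators.

Section Sensing.
Variables (R : realType) (m r d : nat).
Variables (g : 'I_m -> 'M[R[i]]_d) (L : 'I_r -> 'M[R[i]]_d).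
Implicit Types alpha beta v : 'rV[R]_m.

Definition dotp alpha beta : R := \sum_j alpha 0 j * beta 0 j.

Definition generator beta : 'M[R[i]]_d := \sum_j (beta 0 j)%:C *: g j.

(* The real linear combinations of the generators of the Lindblad span. *)
Definition lindblad_span : set 'M[R[i]]_d :=
  [set S | exists (x : R) (y z : 'I_r -> R) (u w : 'I_r -> 'I_r -> R),
    S = x%:C *: 1%:M
        + \sum_a ((y a)%:C *: hpart (L a)
                  + (z a)%:C *: ('i *: ahpart (L a)))
        + \sum_a \sum_b
            ((u a b)%:C *: hpart (adjoint (L a) *m L b)
             + (w a b)%:C *: ('i *: ahpart (adjoint (L a) *m L b)))].

Definition functional_hnls alpha : Prop :=
  forall v, lindblad_span (generator v) -> dotp alpha v = 0.

Definition zeta_star alpha : R :=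
  minimum [set minimum [set spread (generator beta - S) | S in lindblad_span]
          | beta in [set beta | dotp alpha beta = 1]].

(* The operator [h_a I + \sum_b h_ab L_b] *)
Definition shifted_jump (h : 'I_r -> R[i]) (hh : 'M[R[i]]_r) (a : 'I_r) :
    'M[R[i]]_d :=
  h a *: 1%:M + \sum_b hh a b *: L b.

Definition A_op (h : 'I_r -> R[i]) (hh : 'M[R[i]]_r) : 'M[R[i]]_d :=
  \sum_a adjoint (shifted_jump h hh a) *m shifted_jump h hh a.

Definition admissible alpha beta (h0 : R) (h : 'I_r -> R[i])
    (hh : 'M[R[i]]_r) : Prop :=
  [/\ dotp alpha beta = 1, adjoint hh = hh &
    generator beta + h0%:C *: 1%:M
    + \sum_a ((h a)^* *: L a + h a *: adjoint (L a))
    + \sum_a \sum_b hh a b *: (adjoint (L a) *m L b) = 0].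

(* 1 / Gamma^*; a reciprocal, so that Gamma^* may be infinite *)
Definition inv_Gamma_star alpha : R :=
  4 * minimum [set x | exists beta h0 h hh,
                 admissible alpha beta h0 h hh /\ x = opnorm (A_op h hh)].

(* Leading-order optimal quantum Fisher information at sensing time [t]. *)
Definition F_opt (t : R) alpha : R :=
  if `[< functional_hnls alpha >] then t ^+ 2 * zeta_star alpha ^+ 2
  else t * inv_Gamma_star alpha.

Definition single_param (i : 'I_m) : 'rV[R]_m := delta_mx 0 i.

Definition eta (t : R) alpha : R :=
  Num.sqrt ((\sum_(i | alpha 0 i != 0)
               alpha 0 i ^+ 2 / F_opt t (single_param i)) * F_opt t alpha).

End Sensing.

Section Qubits.
Variable R : realType.

Definition pauliX : 'M[R[i]]_2 := delta_mx 0 1 + delta_mx 1 0.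
Definition pauliZ : 'M[R[i]]_2 := delta_mx 0 0 - delta_mx 1 1.
Definition sigma_minus : 'M[R[i]]_2 := delta_mx 0 1.

Variable m : nat.

(* 2 ^ m, in a form that lets [enum_val] read a basis index as a bit string *)
Definition qdim : nat := #|{ffun 'I_m -> 'I_2}|.

(* Kronecker product of the single-qubit operators [A j] *)
Definition tensor (A : 'I_m -> 'M[R[i]]_2) : 'M[R[i]]_qdim :=
  \matrix_(x, y) \prod_j A j ((enum_val x : {ffun 'I_m -> 'I_2}) j)
                             ((enum_val y : {ffun 'I_m -> 'I_2}) j).

Definition on_qubit (A : 'M[R[i]]_2) (i : 'I_m) : 'M[R[i]]_qdim :=
  tensor (fun j => if j == i then A else 1%:M).

Definition average_jump (gamma : 'I_m -> R) (i : 'I_m) : 'M[R[i]]_qdim :=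
  (Num.sqrt (gamma i))%:C *: on_qubit pauliX i.

Definition average_target : 'rV[R]_m := const_mx 1.

(* [ordS] is the cyclic successor of 'I_m, i.e. j + 1 in Z/mZ. *)
Definition fourier_jump (gamma : R) (j : 'I_m) : 'M[R[i]]_qdim :=
  (Num.sqrt gamma)%:C *: (on_qubit sigma_minus j
                          - on_qubit sigma_minus (ordS j)).

Definition fourier_target : 'rV[R]_m :=
  \row_(j < m) cos (2 * pi * j%:R / m%:R).

Definition fourier_eta (gamma t : R) : R :=
  eta (on_qubit pauliX) (fourier_jump gamma) t fourier_target.

End Qubits.

Definition difference_jump (R : realType) (gamma : R) (_ : 'I_1) :
    'M[R[i]]_(qdim 2) :=
  (Num.sqrt gamma)%:C *: (on_qubit (pauliZ R) 0 + on_qubit (pauliZ R) 1).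

Definition difference_target (R : realType) : 'rV[R]_2 :=
  delta_mx 0 0 - delta_mx 0 1.

(* Main.v *)
(** Lower bounds on every minimum come from evaluating at well-chosen basis
    states.  The spread of a Hermitian operator dominates the difference of any
    two of its diagonal entries, and two basis states that no jump operator
    (nor any product of two of them) tells apart give the same diagonal entry
    to every element of the Lindblad span; choosing the states on which the
    signal is extremal settles the Heisenberg-limited cases.  If a basis state
    is annihilated by all jumps, then its diagonal entry of A_h is
    sum_a |h_a|^2, and its row of the constraint loses the terms quadratic in
    the jumps, so that only a linear constraint on h survives, to which
    Cauchy-Schwarz applies; the bound is attained with zero quadratic part,
    where A_h is scalar.  (For the difference noise the linear constraint on h is
    instead the difference of the two extreme diagonal entries of the
    constraint, whose quadratic terms cancel.)  For the Fourier noise this gives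
    F = 4 t / (gamma |D alpha|^2) with D the cyclic difference operator, and
    the Fourier mode is an eigenvector of D^* D with eigenvalue
    4 sin^2 (pi / m). *)

Require Import Defs.
Import Order.TTheory GRing.Theory Num.Theory.
Import numFieldNormedType.Exports.
From mathcomp Require Import ring lra.

Set Implicit Arguments.
Unset Strict Implicit.
Unset Printing Implicit Defensive.

Local Open Scope classical_set_scope.
Local Open Scope complex_scope.
(* Opened last, so that [^*] is [Num.conj], as in the definitions, and not
   [conjc]. *)
Local Open Scope ring_scope.

(** * Attained extrema of sets of reals *)

Section Optimum.
Variable R : realType.
Implicit Types A : set R.

(** By antisymmetry an attained bound is unique, so [xget] has no choice and the default 0 never
    interferes. *)
Lemma minimum_eq A x : A x -> (forall y, A y -> x <= y) -> minimum A = x.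
Proof.
move=> Ax Ale; apply: xget_unique; first by split.
by move=> y [Ay yle]; apply/eqP; rewrite eq_le yle // Ale.
Qed.

Lemma maximum_eq A x : A x -> (forall y, A y -> y <= x) -> maximum A = x.
Proof.
move=> Ax Ale; apply: xget_unique; first by split.
by move=> y [Ay yle]; apply/eqP; rewrite eq_le yle // Ale.
Qed.

End Optimum.

(** * Real parts and moduli of complex numbers *)

Section ComplexParts.
Variable R : realType.
Implicit Types (z w : R[i]) (x : R).

Lemma complexRe_conj z : complex.Re z^* = complex.Re z.
Proof. by case: z. Qed.

Lemma complexReD z w : complex.Re (z + w) = complex.Re z + complex.Re w.
Proof. by case: z; case: w. Qed.

Lemma complexReN z : complex.Re (- z) = - complex.Re z.
Proof. by case: z. Qed.

Lemma complexRe_sum (I : finType) (P : pred I) (F : I -> R[i]) :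
  complex.Re (\sum_(i | P i) F i) = \sum_(i | P i) complex.Re (F i).
Proof. by rewrite (big_morph _ complexReD (erefl : complex.Re 0 = 0)). Qed.

Lemma complexRe_real x z : complex.Re (x%:C * z) = x * complex.Re z.
Proof. by case: z => a b /=; rewrite mul0r subr0. Qed.

Lemma conjC_real x : (x%:C)^* = x%:C.
Proof. by apply/eqP; rewrite eq_complex /= oppr0 !eqxx. Qed.

Lemma conj_mul_self z : z^* * z = (ComplexField.Normc.normc z ^+ 2)%:C.
Proof.
case: z => a b; rewrite /= sqr_sqrtr ?addr_ge0 ?sqr_ge0 //.
apply/eqP; rewrite eq_complex /=; apply/andP; split; apply/eqP; ring.
Qed.

Lemma normc_ge_abs_Re z : `|complex.Re z| <= ComplexField.Normc.normc z.
Proof.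
by case: z => a b; rewrite /= -sqrtr_sqr ler_wsqrtr // lerDl sqr_ge0.
Qed.

Lemma normc_ge0 z : 0 <= ComplexField.Normc.normc z.
Proof. by case: z => a b; rewrite /= sqrtr_ge0. Qed.

Lemma normc_real x : ComplexField.Normc.normc x%:C = `|x|.
Proof. by rewrite /= expr0n addr0 sqrtr_sqr. Qed.

Lemma normc_sum_le (I : finType) (F : I -> R[i]) :
  ComplexField.Normc.normc (\sum_i F i)
    <= \sum_i ComplexField.Normc.normc (F i).
Proof.
elim/big_ind2: _ => //; first by rewrite ComplexField.Normc.normc0.
by move=> a b c d ab cd; rewrite (le_trans (le_normcD _ _)) ?lerD.
Qed.

End ComplexParts.

(** * Adjoints, Hermitian and anti-Hermitian parts *)

Section Adjoint.
Variable R : realType.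

Lemma adjointE p q (A : 'M[R[i]]_(p, q)) i j : adjoint A i j = (A j i)^*.
Proof. by rewrite !mxE. Qed.

Lemma adjointD p q (A B : 'M[R[i]]_(p, q)) :
  adjoint (A + B) = adjoint A + adjoint B.
Proof. by rewrite /adjoint map_mxD linearD. Qed.

Lemma adjointN p q (A : 'M[R[i]]_(p, q)) : adjoint (- A) = - adjoint A.
Proof. by rewrite /adjoint map_mxN linearN. Qed.

Lemma adjointZ p q (a : R[i]) (A : 'M[R[i]]_(p, q)) :
  adjoint (a *: A) = a^* *: adjoint A.
Proof. by rewrite /adjoint map_mxZ linearZ. Qed.

Lemma adjoint_sum p q (I : finType) (F : I -> 'M[R[i]]_(p, q)) :
  adjoint (\sum_i F i) = \sum_i adjoint (F i).
Proof.
by apply: (big_morph _ (@adjointD p q)); rewrite /adjoint map_mx0 trmx0.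
Qed.

Lemma adjointK p q (A : 'M[R[i]]_(p, q)) : adjoint (adjoint A) = A.
Proof. by apply/matrixP => i j; rewrite !adjointE conjCK. Qed.

Lemma adjoint1 d : adjoint (1%:M : 'M[R[i]]_d) = 1%:M.
Proof. by rewrite /adjoint map_mx1 trmx1. Qed.

Lemma adjoint_hpart d (A : 'M[R[i]]_d) : adjoint (hpart A) = hpart A.
Proof.
by rewrite /hpart adjointZ adjointD adjointK addrC fmorphV rmorph_nat.
Qed.

Lemma adjoint_i_ahpart d (A : 'M[R[i]]_d) :
  adjoint ('i *: ahpart A) = 'i *: ahpart A.
Proof.
rewrite /ahpart !adjointZ adjointD adjointN adjointK fmorphV rmorph_nat.
by rewrite conjCi scaleNr -scalerN -[in LHS]opprB -scalerN opprK.
Qed.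

Lemma hpart_herm d (A : 'M[R[i]]_d) : adjoint A = A -> hpart A = A.
Proof.
move=> AE; rewrite /hpart AE; apply/matrixP => i j; rewrite !mxE.
by have h (z : R[i]) : 2%:R^-1 * (z + z) = z; [field|exact: h].
Qed.

Lemma hpart_diag d (A : 'M[R[i]]_d) k :
  hpart A k k = 2%:R^-1 * (A k k + (A k k)^*).
Proof. by rewrite /hpart !mxE. Qed.

Lemma ahpart_diag d (A : 'M[R[i]]_d) k :
  ahpart A k k = 2%:R^-1 * (A k k - (A k k)^*).
Proof. by rewrite /ahpart !mxE. Qed.

End Adjoint.

(** * Spectral theorem and the spread of Hermitian operators *)

Section Spread.
Variables (R : realType) (d : nat).
Implicit Types (A : 'M[R[i]]_d) (x : 'I_d -> R).

Definition real_diag x : 'M[R[i]]_d := diag_mx (\row_k (x k)%:C).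

Lemma real_eigenvalues_diag x : real_eigenvalues (real_diag x) = range x.
Proof.
apply/seteqP; split=> [a /eigenvalueP [v vE v0]|_ [k _ <-]].
  have [k vk] : exists k, v 0 k != 0.
    apply/existsP; apply: contraNT v0; rewrite negb_exists => /forallP v0.
    by apply/eqP/rowP => k; rewrite mxE; apply/eqP/negPn/v0.
  exists k => //; move/rowP/(_ k): vE.
  by rewrite mul_mx_diag !mxE mulrC => /(mulIf vk) [].
apply/eigenvalueP; exists (delta_mx 0 k).
  apply/rowP => l; rewrite mul_mx_diag !mxE eqxx /=.
  by have [->|] := eqVneq l k; rewrite ?mul1r ?mulr1 // mul0r mulr0.
by apply/eqP => /rowP /(_ k); rewrite !mxE !eqxx => /eqP; rewrite oner_eq0.
Qed.

Lemma spread_real_diag x i j :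
  (forall k, x j <= x k <= x i) -> spread (real_diag x) = x i - x j.
Proof.
move=> xb; rewrite /spread real_eigenvalues_diag.
rewrite (@maximum_eq _ _ (x i)); last 2 first.
- by exists i.
- by move=> _ [k _ <-]; have /andP[] := xb k.
rewrite (@minimum_eq _ _ (x j)) //.
by move=> _ [k _ <-]; have /andP[] := xb k.
Qed.

(** [eigenvalue] refers to row vectors, so eigenvectors are transported by right multiplication with
    [P] or its inverse. *)
Lemma real_eigenvalues_conj (P B : 'M[R[i]]_d) : P \in unitmx ->
  real_eigenvalues (invmx P *m B *m P) = real_eigenvalues B.
Proof.
move=> uP; apply/seteqP; split=> a /eigenvalueP [v vE v0].
  apply/eigenvalueP; exists (v *m invmx P).
    by rewrite scalemxAl -vE !mulmxA mulmxK.
  apply: contra v0 => /eqP /(congr1 (mulmx^~ P)).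
  by rewrite mulmxKV // mul0mx => ->.
apply/eigenvalueP; exists (v *m P).
  by rewrite !mulmxA mulmxK // vE scalemxAl.
apply: contra v0 => /eqP /(congr1 (mulmx^~ (invmx P))).
by rewrite mulmxK // mul0mx => ->.
Qed.

(** Both forms of the diagonalisation serve later: the one with the inverse yields the eigenvalues,
    the one with the adjoint the diagonal entries. *)
Lemma hermitian_spectral A : adjoint A = A ->
  exists (P : 'M[R[i]]_d) x, [/\ P \in unitmx, adjoint P *m P = 1%:M,
    A = invmx P *m real_diag x *m P & A = adjoint P *m real_diag x *m P].
Proof.
move=> AE.
have Ah : A \is hermsymmx.
  apply/is_hermitianmxP; rewrite expr0 scale1r -[LHS]AE.
  by apply/matrixP => i j; rewrite !mxE.
set P := spectralmx A.
have uP : P \is unitarymx := spectral_unitarymx A.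
have Pu : P \in unitmx := unitarymx_unit uP.
have PE : invmx P = adjoint P.
  by rewrite invmx_unitary //; apply/matrixP => i j; rewrite !mxE.
exists P, (fun k => complex.Re (spectral_diag A 0 k)).
have DE : diag_mx (spectral_diag A)
    = real_diag (fun k => complex.Re (spectral_diag A 0 k)).
  congr diag_mx; apply/rowP => k; rewrite mxE RRe_real //.
  by have /mxOverP/(_ 0 k) := hermitian_spectral_diag_real Ah.
have := orthomx_spectralP (hermitian_normalmx Ah); rewrite -/P DE => AD.
by split; rewrite -?PE ?mulVmx.
Qed.

(** Each diagonal entry of a Hermitian matrix is a convex combination of its eigenvalues, hence lies
    between the smallest and the largest of them. *)
Lemma spread_ge_diag A i j : adjoint A = A ->
  complex.Re (A i i) - complex.Re (A j j) <= spread A.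
Proof.
move=> /hermitian_spectral [P [x [Pu PP AE AE']]].
have [imax _ maxP] := @arg_maxP _ R _ i predT x isT.
have [imin _ minP] := @arg_minP _ R _ i predT x isT.
have xb k : x imin <= x k <= x imax.
  by apply/andP; split; [exact: minP | exact: maxP].
have -> : spread A = x imax - x imin.
  by rewrite -(spread_real_diag xb) /spread AE real_eigenvalues_conj.
(* The weights: the columns of the unitary [P] are unit vectors, so each [p k] sums to 1. *)
pose p k l := ComplexField.Normc.normc (P l k) ^+ 2.
have p_ge0 k l : 0 <= p k l by rewrite sqr_ge0.
have p1 k : \sum_l p k l = 1.
  have /matrixP /(_ k k) := PP; rewrite !mxE eqxx.
  move=> /(congr1 (@complex.Re R)) /= <-; rewrite complexRe_sum.
  by apply: eq_bigr => l _; rewrite adjointE conj_mul_self.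
have AkE k : complex.Re (A k k) = \sum_l p k l * x l.
  rewrite AE' mxE complexRe_sum; apply: eq_bigr => l _.
  rewrite mul_mx_diag !mxE mulrAC conj_mul_self -rmorphM.
  by rewrite mulrC.
rewrite !AkE lerB //.
  by rewrite -[x imax]mul1r -(p1 i) mulr_suml ler_sum // => l _;
    rewrite ler_wpM2l //; have /andP[] := xb l.
by rewrite -[x imin]mul1r -(p1 j) mulr_suml ler_sum // => l _;
  rewrite ler_wpM2l //; have /andP[] := xb l.
Qed.

End Spread.

(** * Operator norm *)

Section Opnorm.
Variables (R : realType) (d : nat).
Implicit Types (A : 'M[R[i]]_d) (v : 'cV[R[i]]_d).

Lemma l2norm_delta k : l2norm (delta_mx k 0 : 'cV[R[i]]_d) = 1.
Proof.
rewrite /l2norm (bigD1 k) //= big1 => [|l lk].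
  by rewrite mxE !eqxx (normc_real 1) normr1 expr1n addr0 sqrtr1.
by rewrite mxE (negbTE lk) (normc_real 0) normr0 expr0n.
Qed.

Lemma normc_le_l2norm v k : ComplexField.Normc.normc (v k 0) <= l2norm v.
Proof.
rewrite -[leLHS]ger0_norm ?normc_ge0 // -sqrtr_sqr ler_wsqrtr //.
by rewrite (bigD1 k) //= lerDl sumr_ge0 // => l _; rewrite sqr_ge0.
Qed.

Lemma l2normZ a v : l2norm (a *: v) = ComplexField.Normc.normc a * l2norm v.
Proof.
rewrite /l2norm -[X in _ = X * _]ger0_norm ?normc_ge0 // -sqrtr_sqr.
rewrite -sqrtrM ?sqr_ge0 //; congr Num.sqrt; rewrite mulr_sumr.
by apply: eq_bigr => k _; rewrite mxE ComplexField.Normc.normcM exprMn.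
Qed.

Lemma opnorm_scalar (c : R) : (0 < d)%N -> 0 <= c ->
  opnorm (c%:C *: 1%:M : 'M[R[i]]_d) = c.
Proof.
move=> d0 c0; rewrite /opnorm.
suff -> : [set l2norm ((c%:C *: 1%:M : 'M[R[i]]_d) *m v)
    | v in [set v | l2norm v = 1]] = [set c] by rewrite sup1.
apply/seteqP; split=> [_ [v v1 <-]|_ ->] /=.
  by rewrite -scalemxAl mul1mx l2normZ v1 mulr1 normc_real ger0_norm.
exists (delta_mx (Ordinal d0) 0); first exact: l2norm_delta.
by rewrite -scalemxAl mul1mx l2normZ l2norm_delta mulr1 normc_real ger0_norm.
Qed.

(** The coordinates of a unit vector have modulus at most 1, so row sums of moduli give a crude
    bound; it makes the [sup] in [opnorm] a genuine supremum. *)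
Lemma opnorm_has_ubound A :
  has_ubound [set l2norm (A *m v) | v in [set v | l2norm v = 1]].
Proof.
exists (Num.sqrt (\sum_k (\sum_l ComplexField.Normc.normc (A k l)) ^+ 2)).
move=> _ [v /= v1 <-]; apply/ler_wsqrtr/ler_sum => k _.
rewrite lerXn2r ?nnegrE ?normc_ge0 ?sumr_ge0 // => [*|]; rewrite ?normc_ge0 //.
rewrite mxE (le_trans (normc_sum_le _)) // ler_sum // => l _.
rewrite ComplexField.Normc.normcM ler_piMr ?normc_ge0 //.
by rewrite -v1 normc_le_l2norm.
Qed.

(** The entry is one coordinate of the image of the [k]-th basis vector, a unit vector. *)
Lemma opnorm_ge_diag A k : complex.Re (A k k) <= opnorm A.
Proof.
apply: le_trans (_ : l2norm (A *m delta_mx k 0) <= _).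
  rewrite (le_trans (ler_norm _)) // (le_trans (normc_ge_abs_Re _)) //.
  by rewrite -colE (le_trans _ (normc_le_l2norm _ k)) // mxE.
apply: ub_le_sup; first exact: opnorm_has_ubound.
by exists (delta_mx k 0) => //; rewrite /= l2norm_delta.
Qed.

End Opnorm.

(** * The sensing problem *)

Section LindbladSpan.
Variables (R : realType) (r d : nat) (L : 'I_r -> 'M[R[i]]_d).

(** Trades the explicit coefficients for an induction over real combinations; restricting to real
    scalars is what lets self-adjointness pass through. *)
Lemma lindblad_span_ind (P : 'M[R[i]]_d -> Prop) :
  (forall A B, P A -> P B -> P (A + B)) ->
  (forall (x : R) A, P A -> P (x%:C *: A)) ->
  P 1%:M -> (forall a, P (hpart (L a))) -> (forall a, P ('i *: ahpart (L a))) ->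
  (forall a b, P (hpart (adjoint (L a) *m L b))) ->
  (forall a b, P ('i *: ahpart (adjoint (L a) *m L b))) ->
  forall S, lindblad_span L S -> P S.
Proof.
move=> PD PZ P1 Ph Pa Phh Paa _ [x [y [z [u [w ->]]]]].
have P0 : P 0 by rewrite -(scale0r 1%:M); apply: (PZ 0).
have Psum F : (forall a : 'I_r, P (F a)) -> P (\sum_a F a).
  by move=> PF; elim/big_ind: _.
apply: (PD); first apply: (PD); first exact: PZ.
  by apply: (Psum) => a; apply: PD; exact: PZ.
by apply: (Psum) => a; apply: (Psum) => b; apply: PD; exact: PZ.
Qed.

(** Supplies every explicit member of the span used below, including 0 (as [c = 0]). *)
Lemma lindblad_span_hpart a (c : R) : lindblad_span L (c%:C *: hpart (L a)).
Proof.
exists 0, (fun b => if b == a then c else 0), (fun=> 0), (fun _ _ => 0),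
  (fun _ _ => 0).
rewrite scale0r add0r [X in _ + X]big1 => [|b _]; last first.
  by rewrite big1 // => b' _; rewrite !scale0r addr0.
rewrite addr0 (bigD1 a) //= eqxx big1 => [|b /negbTE ->].
  by rewrite scale0r !addr0.
by rewrite !scale0r addr0.
Qed.

Lemma lindblad_span_adjoint S : lindblad_span L S -> adjoint S = S.
Proof.
move: S; apply: lindblad_span_ind => [A B AE BE|x A AE||a|a|a b|a b].
- by rewrite adjointD AE BE.
- by rewrite adjointZ AE conjC_real.
- exact: adjoint1.
- exact: adjoint_hpart.
- exact: adjoint_i_ahpart.
- exact: adjoint_hpart.
- exact: adjoint_i_ahpart.
Qed.

(** Agreement of two diagonal entries is a linear condition, and a diagonal entry of [hpart] or
    [ahpart] depends only on the same entry of the original matrix. *)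
Lemma lindblad_span_diag_eq k l : (forall a, L a k k = L a l l) ->
    (forall a b, (adjoint (L a) *m L b) k k = (adjoint (L a) *m L b) l l) ->
  forall S, lindblad_span L S -> S k k = S l l.
Proof.
move=> Lkl LLkl; apply: lindblad_span_ind => [A B AE BE|x A AE||a|a|a b|a b].
- by rewrite !mxE AE BE.
- by rewrite !mxE AE.
- by rewrite !mxE !eqxx.
- by rewrite !hpart_diag Lkl.
- by rewrite [LHS]mxE [RHS]mxE !ahpart_diag Lkl.
- by rewrite !hpart_diag LLkl.
- by rewrite [LHS]mxE [RHS]mxE !ahpart_diag LLkl.
Qed.

End LindbladSpan.

(** * The two optimisation problems behind [F_opt] *)

Section Sensing.
Variables (R : realType) (m r d : nat).
Variables (g : 'I_m -> 'M[R[i]]_d) (L : 'I_r -> 'M[R[i]]_d).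
Implicit Types alpha beta v : 'rV[R]_m.

Lemma dotp_single i v : dotp (single_param R i) v = v 0 i.
Proof.
rewrite /dotp (bigD1 i) //= big1 => [|j ji].
  by rewrite mxE !eqxx mul1r addr0.
by rewrite mxE (negbTE ji) andbF mul0r.
Qed.

Lemma adjoint_generator beta : (forall j, adjoint (g j) = g j) ->
  adjoint (generator g beta) = generator g beta.
Proof.
move=> gE; rewrite /generator adjoint_sum; apply: eq_bigr => j _.
by rewrite adjointZ gE conjC_real.
Qed.

(** The entries of [S] at [k] and [l] agree and cancel in the difference, so the bound is uniform in
    [S]. *)
Lemma spread_generator_sub_ge k l beta S : (forall j, adjoint (g j) = g j) ->
    (forall a, L a k k = L a l l) ->
    (forall a b, (adjoint (L a) *m L b) k k = (adjoint (L a) *m L b) l l) ->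
    lindblad_span L S ->
  complex.Re (generator g beta k k) - complex.Re (generator g beta l l)
    <= spread (generator g beta - S).
Proof.
move=> gE Lkl LLkl LS.
have SE : adjoint (generator g beta - S) = generator g beta - S.
  by rewrite adjointD adjointN adjoint_generator // (lindblad_span_adjoint LS).
apply: le_trans (spread_ge_diag k l SE).
rewrite [(_ - S) k k]mxE [(- S) k k]mxE [(_ - S) l l]mxE [(- S) l l]mxE.
rewrite (lindblad_span_diag_eq Lkl LLkl LS) !complexReD !complexReN.
by rewrite opprD opprK addrACA addNr addr0.
Qed.

(** Separates the nested minimum: [z] is the value of the inner problem over the span, [beta0] a
    minimiser of the outer one. *)
Lemma zeta_star_eq alpha (z : 'rV[R]_m -> R) beta0 :
    (forall beta, dotp alpha beta = 1 ->
       (exists2 S, lindblad_span L S & spread (generator g beta - S) = z beta)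
       /\ forall S, lindblad_span L S ->
            z beta <= spread (generator g beta - S)) ->
    dotp alpha beta0 = 1 ->
    (forall beta, dotp alpha beta = 1 -> z beta0 <= z beta) ->
  zeta_star g L alpha = z beta0.
Proof.
move=> zP beta01 zmin.
have inner beta : dotp alpha beta = 1 ->
    minimum [set spread (generator g beta - S) | S in lindblad_span L]
    = z beta.
  move=> /zP [[S LS SE] zle]; apply: minimum_eq; first by exists S.
  by move=> _ [S' LS' <-]; exact: zle.
apply: minimum_eq; first by exists beta0 => //; rewrite inner.
by move=> _ [beta /= beta1 <-]; rewrite inner // zmin.
Qed.

Lemma shifted_jump0 (h : 'I_r -> R[i]) a :
  shifted_jump L h 0 a = h a *: 1%:M.
Proof.
rewrite /shifted_jump big1 ?addr0 // => b _.
by rewrite mxE scale0r.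
Qed.

Lemma A_op_scalar (h : 'I_r -> R[i]) :
  A_op L h 0 = (\sum_a ComplexField.Normc.normc (h a) ^+ 2)%:C *: 1%:M.
Proof.
rewrite rmorph_sum scaler_suml; apply: eq_bigr => a _.
rewrite shifted_jump0 adjointZ adjoint1 -scalemxAl mul1mx scalerA.
by rewrite conj_mul_self.
Qed.

(** On a state killed by all jumps, [shifted_jump] acts as the scalar [h a], whatever [hh] is. *)
Lemma A_op_dark_diag h hh k : (forall b l, L b l k = 0) ->
  complex.Re (A_op L h hh k k) = \sum_a ComplexField.Normc.normc (h a) ^+ 2.
Proof.
move=> Lk; rewrite /A_op summxE complexRe_sum; apply: eq_bigr => a _.
have sjE l : shifted_jump L h hh a l k = h a *+ (l == k).
  rewrite !mxE summxE big1 ?addr0 ?mulr_natr // => b _.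
  by rewrite mxE Lk mulr0.
rewrite mxE (bigD1 k) //= big1 ?addr0 => [|l lk].
  by rewrite adjointE !sjE eqxx conj_mul_self.
by rewrite !sjE (negbTE lk) mulr0.
Qed.

Lemma A_op_dark_ge h hh k : (forall b l, L b l k = 0) ->
  \sum_a ComplexField.Normc.normc (h a) ^+ 2 <= opnorm (A_op L h hh).
Proof. by move=> Lk; rewrite -(A_op_dark_diag h hh Lk) opnorm_ge_diag. Qed.

(** Row [k] of every [adjoint (L a)] vanishes, which removes the terms [h a *: adjoint (L a)] and
    the whole quadratic part, so [hh] drops out. *)
Lemma admissible_dark alpha beta h0 h hh k l : (forall b n, L b n k = 0) ->
    admissible g L alpha beta h0 h hh ->
  generator g beta k l + h0%:C *+ (k == l) + \sum_a (h a)^* * L a k l = 0.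
Proof.
move=> Lk [_ _ /matrixP /(_ k l)].
set T1 := \sum_a (_ + _); set T2 := \sum_a \sum_b _.

have T2kl : T2 k l = 0.
  rewrite summxE big1 // => a _; rewrite summxE big1 // => b _.
  rewrite mxE mxE big1 ?mulr0 // => n _.
  by rewrite adjointE Lk conjC0 mul0r.
have T1kl : T1 k l = \sum_a (h a)^* * L a k l.
  rewrite summxE; apply: eq_bigr => a _.
  by rewrite !mxE Lk conjC0 mulr0 addr0.
rewrite mxE T2kl addr0 mxE T1kl mxE; move: (generator g beta k l) => G.
by rewrite !mxE mulr_natr.
Qed.

(** The dark state bounds [opnorm (A_op L h hh)] below by the squared length of [h], with equality
    at [hh = 0]; what remains is to minimise that length. *)
Lemma inv_Gamma_star_eq alpha c k : (forall b l, L b l k = 0) ->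
    (forall beta h0 h hh, admissible g L alpha beta h0 h hh ->
       c <= \sum_a ComplexField.Normc.normc (h a) ^+ 2) ->
    (exists beta h0 h, admissible g L alpha beta h0 h 0 /\
       \sum_a ComplexField.Normc.normc (h a) ^+ 2 = c) ->
  inv_Gamma_star g L alpha = 4 * c.
Proof.
move=> Lk cle [beta [h0 [h [adm cE]]]]; congr (4 * _).
apply: minimum_eq => [|_ [beta' [h0' [h' [hh' [adm' ->]]]]]]; last first.
  exact: le_trans (cle _ _ _ _ adm') (A_op_dark_ge _ _ Lk).
exists beta, h0, h, 0; split=> //.
rewrite A_op_scalar opnorm_scalar ?cE //.
  exact: leq_ltn_trans (ltn_ord k).
by rewrite -cE sumr_ge0 // => a _; rewrite sqr_ge0.
Qed.

End Sensing.

(** * Qubit operators *)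

Section Tensor.
Variables (R : realType) (m : nat).
Implicit Types (A B : 'I_m -> 'M[R[i]]_2) (a b : 'M[R[i]]_2) (i j : 'I_m).

Definition bits (k : 'I_(qdim m)) : {ffun 'I_m -> 'I_2} := enum_val k.
Definition ket (f : {ffun 'I_m -> 'I_2}) : 'I_(qdim m) := enum_rank f.

Lemma ketK f : bits (ket f) = f.
Proof. exact: enum_rankK. Qed.

Lemma bits_inj : injective bits.
Proof. exact: enum_val_inj. Qed.

Lemma tensorE A k l : tensor A k l = \prod_j A j (bits k j) (bits l j).
Proof. by rewrite mxE. Qed.

Lemma adjoint_tensor A : adjoint (tensor A) = tensor (fun j => adjoint (A j)).
Proof.
apply/matrixP => k l; rewrite adjointE !tensorE rmorph_prod.
by apply: eq_bigr => j _; rewrite adjointE.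
Qed.

(** Expanding a product of two-term sums gives a sum over all bit strings, which [ket] identifies
    with the intermediate basis states of the matrix product. *)
Lemma tensorM A B : tensor A *m tensor B = tensor (fun j => A j *m B j).
Proof.
apply/matrixP => k l; rewrite mxE tensorE.
under [RHS]eq_bigr do rewrite mxE.
rewrite bigA_distr_bigA /= (reindex_onto ket bits) => /= [|n _]; last first.
  exact: enum_valK.
apply: eq_big => [f|f _]; first by rewrite ketK eqxx.
by rewrite !tensorE -big_split ketK.
Qed.

Lemma tensor1 : tensor (fun=> 1%:M) = 1%:M :> 'M[R[i]]_(qdim m).
Proof.
apply/matrixP => k l; rewrite tensorE [RHS]mxE.
have [->|kl] := eqVneq k l.
  by rewrite big1 // => j _; rewrite mxE eqxx.
have [j klj] : exists j, bits k j != bits l j.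
  apply/existsP; apply: contraNT kl; rewrite negb_exists => /forallP kl.
  by apply/eqP/bits_inj/ffunP => j; apply/eqP/negPn/kl.
by rewrite (bigD1 j) //= mxE (negbTE klj) mul0r.
Qed.

Lemma on_qubitE a i k l : on_qubit a i k l
  = a (bits k i) (bits l i) * \prod_(j | j != i) (bits k j == bits l j)%:R.
Proof.
rewrite /on_qubit tensorE (bigD1 i) //= eqxx; congr (_ * _).
by apply: eq_bigr => j /negbTE ->; rewrite mxE.
Qed.

Lemma on_qubitD a b i : on_qubit (a + b) i = on_qubit a i + on_qubit b i.
Proof.
by apply/matrixP => k l; rewrite [RHS]mxE !on_qubitE mxE mulrDl.
Qed.

Lemma adjoint_on_qubit a i : adjoint (on_qubit a i) = on_qubit (adjoint a) i.
Proof.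
rewrite /on_qubit adjoint_tensor; congr tensor; apply/funext => j.
by case: eqP => // _; rewrite adjoint1.
Qed.

Lemma on_qubit_local a i k l : (forall j, j != i -> bits k j = bits l j) ->
  on_qubit a i k l = a (bits k i) (bits l i).
Proof.
move=> kl; rewrite on_qubitE big1 ?mulr1 // => j ji.
by rewrite kl // eqxx.
Qed.

Lemma on_qubit_diag a i k : on_qubit a i k k = a (bits k i) (bits k i).
Proof. exact: on_qubit_local. Qed.

Lemma on_qubit_off a i j k l : j != i -> bits k j != bits l j ->
  on_qubit a i k l = 0.
Proof.
by move=> ji kl; rewrite on_qubitE (bigD1 j) //= (negbTE kl) mul0r mulr0.
Qed.

Lemma on_qubit_eq0 a i k l : a (bits k i) (bits l i) = 0 ->
  on_qubit a i k l = 0.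
Proof. by move=> a0; rewrite on_qubitE a0 mul0r. Qed.

End Tensor.

(** * Algebra of real diagonal operators *)

Section RealDiag.
Variables (R : realType) (d : nat).
Implicit Types x y : 'I_d -> R.

Lemma real_diagE x k l : real_diag x k l = (x k)%:C *+ (k == l).
Proof. by rewrite !mxE; case: eqVneq => [->|]. Qed.

Lemma real_diagD x y :
  real_diag x + real_diag y = real_diag (fun k => x k + y k).
Proof.
by apply/matrixP => k l; rewrite mxE !real_diagE rmorphD mulrnDl.
Qed.

Lemma real_diagZ (c : R) x :
  c%:C *: real_diag x = real_diag (fun k => c * x k).
Proof. by apply/matrixP => k l; rewrite mxE !real_diagE rmorphM mulrnAr. Qed.

Lemma real_diagN x : - real_diag x = real_diag (fun k => - x k).
Proof. by apply/matrixP => k l; rewrite mxE !real_diagE rmorphN mulNrn. Qed.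

Lemma real_diag_sum (I : finType) (F : I -> 'I_d -> R) :
  \sum_i real_diag (F i) = real_diag (fun k => \sum_i F i k).
Proof.
apply/matrixP => k l; rewrite summxE real_diagE rmorph_sum -sumrMnl.
by apply: eq_bigr => i _; rewrite real_diagE.
Qed.

Lemma real_diagM x y :
  real_diag x *m real_diag y = real_diag (fun k => x k * y k).
Proof.
apply/matrixP => k l; rewrite mul_diag_mx [LHS]mxE [X in X * _]mxE !real_diagE.
by rewrite rmorphM mulrnAr.
Qed.

Lemma adjoint_real_diag x : adjoint (real_diag x) = real_diag x.
Proof.
apply/matrixP => k l; rewrite adjointE !real_diagE rmorphMn /= eq_sym.
by case: eqVneq => [->|]; rewrite ?mulr1n ?mulr0n // conjC_real.
Qed.

End RealDiag.

(** * Pauli operators on qubits *)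

Section Pauli.
Variables (R : realType) (m : nat).

(** The eigenvalue of [pauliZ] on the basis state [b]. *)
Definition spin (b : 'I_2) : R := if b == 0 then 1 else -1.

Lemma ord2_cases (b : 'I_2) : b = 0 \/ b = 1.
Proof.
by case: b => [[|[|[]]] //] ?; [left|right]; apply: val_inj.
Qed.

Lemma pauliZE b c : pauliZ R b c = (spin b)%:C *+ (b == c).
Proof.
rewrite !mxE /spin.
case: (ord2_cases b) => ->; case: (ord2_cases c) => -> /=;
  by rewrite ?subr0 ?sub0r ?oppr0 ?subrr ?mulr1n ?mulr0n ?rmorphN ?rmorph1.
Qed.

Lemma on_qubit_pauliZ (i : 'I_m) :
  on_qubit (pauliZ R) i = real_diag (fun k => spin (bits k i)).
Proof.
apply/matrixP => k l; rewrite real_diagE.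
have [<-|kl] := eqVneq k l; first by rewrite on_qubit_diag pauliZE eqxx.
have [ki|ki] := eqVneq (bits k i) (bits l i); last first.
  by rewrite on_qubit_eq0 // pauliZE (negbTE ki).
have [j klj] : exists j, bits k j != bits l j.
  apply/existsP; apply: contraNT kl; rewrite negb_exists => /forallP kl.
  by apply/eqP/bits_inj/ffunP => j; apply/eqP/negPn/kl.
(* The strings agree at [i], so the differing bit belongs to another qubit, where the identity
   factor vanishes. *)
rewrite (on_qubit_off _ _ klj) //.
by apply: contraNneq klj => ->; rewrite ki.
Qed.

Lemma generator_pauliZ (beta : 'rV[R]_m) :
  generator (on_qubit (pauliZ R)) beta
    = real_diag (fun k => \sum_j beta 0 j * spin (bits k j)).
Proof.
rewrite -real_diag_sum; apply: eq_bigr => j _.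
by rewrite on_qubit_pauliZ real_diagZ.
Qed.

Lemma adjoint_pauliX : adjoint (pauliX R) = pauliX R.
Proof.
apply/matrixP => i j; rewrite adjointE !mxE.
by rewrite rmorphD !rmorph_nat addrC ![(j == _) && _]andbC.
Qed.

Lemma pauliX_diag b : pauliX R b b = 0.
Proof. by rewrite !mxE; case: (ord2_cases b) => ->; rewrite /= addr0. Qed.

Lemma pauliX_sqr : pauliX R *m pauliX R = 1%:M.
Proof.
apply/matrixP => i j; rewrite !mxE !big_ord_recl big_ord0 !mxE.
case: (ord2_cases i) => ->; case: (ord2_cases j) => -> /=;
  by rewrite ?(addr0, add0r, mulr0, mul0r, mulr1).
Qed.

Lemma pauliX_sigma : pauliX R = sigma_minus R + adjoint (sigma_minus R).
Proof.
apply/matrixP => i j; rewrite [RHS]mxE adjointE !mxE rmorph_nat.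
by rewrite [(j == _) && _]andbC.
Qed.

End Pauli.

(** * Average *)

Section Average.
Variables (R : realType) (m : nat) (gamma : 'I_m -> R).
Implicit Types (alpha beta v : 'rV[R]_m).
Local Notation g := (on_qubit (pauliZ R)).
Local Notation L := (average_jump gamma).

Lemma adjoint_on_qubit_pauliZ (i : 'I_m) : adjoint (g i) = g i.
Proof. by rewrite on_qubit_pauliZ adjoint_real_diag. Qed.

Lemma average_jump_diag a k : L a k k = 0.
Proof. by rewrite mxE on_qubit_diag pauliX_diag mulr0. Qed.

(** Flips of the same qubit cancel, while for distinct qubits an uncancelled flip has zero diagonal;
    in both cases the entry is independent of [k]. *)
Lemma on_qubit_pauliX_mul_diag (a b : 'I_m) k :
  (on_qubit (pauliX R) a *m on_qubit (pauliX R) b) k k = (a == b)%:R.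
Proof.
rewrite tensorM; have [<-|ab] := eqVneq a b.
  rewrite [X in tensor X](_ : _ = fun=> 1%:M) ?tensor1 ?mxE ?eqxx //.
  by apply/funext => j; case: eqP => // _; [exact: pauliX_sqr|rewrite mulmx1].
rewrite tensorE (bigD1 a) //= eqxx (negbTE ab) mulmx1.
by rewrite pauliX_diag mul0r.
Qed.

Lemma average_jump_mul_diag a b k l :
  (adjoint (L a) *m L b) k k = (adjoint (L a) *m L b) l l.
Proof.
rewrite /average_jump adjointZ adjoint_on_qubit adjoint_pauliX.
rewrite -scalemxAl -scalemxAr scalerA [LHS]mxE [RHS]mxE.
by rewrite !on_qubit_pauliX_mul_diag.
Qed.

(** Each spin is aligned with the sign of its coefficient, which gives the top eigenvalue of
    [generator g v]; the complementary string [cosign_ket] gives the bottom one. *)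
Definition sign_ket v : 'I_(qdim m) :=
  ket [ffun j => if v 0 j < 0 then 1 else 0].
Definition cosign_ket v : 'I_(qdim m) :=
  ket [ffun j => if v 0 j < 0 then 0 else 1].

Lemma generator_sign_ket v :
  generator g v (sign_ket v) (sign_ket v) = (\sum_j `|v 0 j|)%:C.
Proof.
rewrite generator_pauliZ real_diagE eqxx mulr1n; congr (_%:C).
apply: eq_bigr => j _; rewrite ketK ffunE.
case: ltP => v0; rewrite /spin /= ?mulr1 ?mulrN1.
  by rewrite ltr0_norm.
by rewrite ger0_norm.
Qed.

Lemma generator_cosign_ket v :
  generator g v (cosign_ket v) (cosign_ket v) = (- \sum_j `|v 0 j|)%:C.
Proof.
rewrite generator_pauliZ real_diagE eqxx mulr1n -sumrN; congr (_%:C).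
apply: eq_bigr => j _; rewrite ketK ffunE.
case: ltP => v0; rewrite /spin /= ?mulr1 ?mulrN1.
  by rewrite ltr0_norm // opprK.
by rewrite ger0_norm.
Qed.

(** Equal entries on the two extremal states force the 1-norm of [v] to equal its own negative, so
    [v] is zero. *)
Lemma average_hnls alpha : functional_hnls g L alpha.
Proof.
move=> v Lv; have := lindblad_span_diag_eq (k := sign_ket v)
  (l := cosign_ket v) _ (fun a b => average_jump_mul_diag a b _ _) Lv.
rewrite generator_sign_ket generator_cosign_ket => vE.
have {vE} /complexI vE := vE (fun a => etrans (average_jump_diag a _)
  (esym (average_jump_diag a _))).
have v0 : \sum_j `|v 0 j| = 0 by lra.
rewrite /dotp big1 // => j _.
have /(_ j isT)/eqP := psumr_eq0P (fun j _ => normr_ge0 (v 0 j)) v0.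
by rewrite normr_eq0 => /eqP ->; rewrite mulr0.
Qed.

(** The inner minimum is twice the 1-norm of [beta], reached at [S = 0]. The outer one is the
    duality of 1-norm and sup-norm: the hypotheses say that [alpha] has sup-norm 1, attained at [i],
    which covers the average and the single parameters alike. *)
Lemma zeta_star_average alpha i : (forall j, `|alpha 0 j| <= 1) ->
  alpha 0 i = 1 -> zeta_star g L alpha = 2.
Proof.
move=> alpha1 alphai.
rewrite (zeta_star_eq (z := fun beta => 2 * \sum_j `|beta 0 j|)
  (beta0 := single_param R i)).
- rewrite (bigD1 i) //= big1 => [|j ji]; last first.
    by rewrite mxE (negbTE ji) andbF normr0.
  by rewrite mxE !eqxx normr1 addr0 mulr1.
- move=> beta _; split.
    exists 0.
      rewrite -(scale0r (hpart (L i))); exact: (lindblad_span_hpart _ _ 0).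
    rewrite subr0 generator_pauliZ.
    rewrite (spread_real_diag (i := sign_ket beta) (j := cosign_ket beta)).
      have := generator_sign_ket beta; have := generator_cosign_ket beta.
      rewrite generator_pauliZ !real_diagE !eqxx !mulr1n.
      by move=> /complexI -> /complexI ->; ring.
    move=> k; have := generator_sign_ket beta.
    have := generator_cosign_ket beta.
    rewrite generator_pauliZ !real_diagE !eqxx !mulr1n.
    move=> /complexI -> /complexI ->; rewrite -ler_norml.
    (* Spins have modulus 1, so no eigenvalue exceeds the 1-norm in modulus. *)
    rewrite (le_trans (ler_norm_sum _ _ _)) // ler_sum // => j _.
    rewrite normrM /spin; case: ifP => _; by rewrite ?normrN1 ?normr1 mulr1.
  move=> S LS; have := spread_generator_sub_ge (k := sign_ket beta)
    (l := cosign_ket beta) beta adjoint_on_qubit_pauliZ _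
    (fun a b => average_jump_mul_diag a b _ _) LS.
  rewrite generator_sign_ket generator_cosign_ket => sE.
  have {sE} := sE (fun a => etrans (average_jump_diag a _)
    (esym (average_jump_diag a _))).
  by rewrite /= opprK -mulr2n mulr_natl.
- rewrite /dotp (bigD1 i) //= big1 => [|j ji]; last first.
    by rewrite mxE (negbTE ji) andbF mulr0.
  by rewrite mxE !eqxx mulr1 alphai addr0.
move=> beta beta1; rewrite ler_pM2l // (bigD1 i) //= big1 => [|j ji].
  rewrite mxE !eqxx normr1 addr0 -beta1 ler_sum // => j _.
  rewrite (le_trans (ler_norm _)) // normrM -[leRHS]mul1r.
  by rewrite ler_wpM2r // normr_ge0.
by rewrite mxE (negbTE ji) andbF normr0.
Qed.

Lemma F_opt_average alpha i t : (forall j, `|alpha 0 j| <= 1) ->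
  alpha 0 i = 1 -> F_opt g L t alpha = t ^+ 2 * 2 ^+ 2.
Proof.
move=> alpha1 alphai; rewrite /F_opt asboolT; last exact: average_hnls.
by rewrite (zeta_star_average alpha1 alphai).
Qed.

Lemma single_param_le1 i (j : 'I_m) : `|single_param R i 0 j| <= 1.
Proof. by rewrite mxE eqxx /=; case: eqP; rewrite ?normr1 ?normr0. Qed.

Lemma single_param_eq1 (i : 'I_m) : single_param R i 0 i = 1.
Proof. by rewrite mxE !eqxx. Qed.

Lemma eta_average t : (0 < m)%N -> 0 < t ->
  eta g L t (average_target R m) = Num.sqrt m%:R.
Proof.
move=> m0 t0; rewrite /eta; congr Num.sqrt.
have tn0 : t != 0 by rewrite gt_eqF.
rewrite (@F_opt_average _ (Ordinal m0)); last 2 first.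
- by move=> j; rewrite mxE normr1.
- by rewrite mxE.
(* All the informations equal 4 t^2, so the ratio just counts the qubits. *)
transitivity (\sum_(i < m) (t ^+ 2 * 2 ^+ 2 : R)^-1 * (t ^+ 2 * 2 ^+ 2)).
  rewrite -mulr_suml; congr (_ * _).
  apply: eq_big => [i|i _]; first by rewrite mxE oner_eq0.
  rewrite mxE expr1n mul1r (@F_opt_average _ i) //.
    exact: single_param_le1.
  exact: single_param_eq1.
rewrite sumr_const card_ord; congr (_ *+ _); field; exact: tn0.
Qed.

End Average.

(** * Difference *)

Lemma sqrtr_neq0 (R : rcfType) (x : R) : 0 < x -> Num.sqrt x != 0.
Proof. by move=> x0; rewrite gt_eqF // sqrtr_gt0. Qed.

Section Difference.
Variables (R : realType) (gamma : R).
Hypothesis gamma_gt0 : 0 < gamma.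
Implicit Types (beta v : 'rV[R]_2).
Local Notation g := (on_qubit (m := 2) (pauliZ R)).
Local Notation L := (difference_jump gamma).

Definition ket2 (a b : 'I_2) : 'I_(qdim 2) :=
  ket [ffun j => if j == 0 then a else b].

Lemma bits_ket2 a b j : bits (ket2 a b) j = if j == 0 then a else b.
Proof. by rewrite ketK ffunE. Qed.

Let jump_diag (k : 'I_(qdim 2)) : R :=
  Num.sqrt gamma * (spin R (bits k 0) + spin R (bits k 1)).

Lemma difference_jump_diag a : L a = real_diag jump_diag.
Proof. by rewrite /difference_jump !on_qubit_pauliZ real_diagD real_diagZ. Qed.

Lemma jump_diagE :
  [/\ jump_diag (ket2 0 0) = 2 * Num.sqrt gamma,
      jump_diag (ket2 0 1) = 0, jump_diag (ket2 1 0) = 0 &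
      jump_diag (ket2 1 1) = - (2 * Num.sqrt gamma)].
Proof. by split; rewrite /jump_diag !bits_ket2 /spin /=; ring. Qed.

Lemma generator_pauliZ2 v : generator g v
  = real_diag (fun k => v 0 0 * spin R (bits k 0) + v 0 1 * spin R (bits k 1)).
Proof.
rewrite generator_pauliZ; congr real_diag; apply/funext => k.
rewrite !big_ord_recl big_ord0 addr0.
by rewrite (_ : lift ord0 ord0 = 1) //; apply: val_inj.
Qed.

Lemma difference_jump_mul_diag a b :
  adjoint (L a) *m L b = real_diag (fun k => jump_diag k * jump_diag k).
Proof. by rewrite !difference_jump_diag adjoint_real_diag real_diagM. Qed.

Lemma dark_diag_eq a : L a (ket2 0 1) (ket2 0 1) = L a (ket2 1 0) (ket2 1 0).
Proof.
rewrite difference_jump_diag !real_diagE !eqxx.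
by have [_ -> -> _] := jump_diagE.
Qed.

Lemma dark_mul_diag_eq a b :
  (adjoint (L a) *m L b) (ket2 0 1) (ket2 0 1)
    = (adjoint (L a) *m L b) (ket2 1 0) (ket2 1 0).
Proof.
rewrite difference_jump_mul_diag !real_diagE !eqxx.
by have [_ -> -> _] := jump_diagE.
Qed.

Lemma dark_state k : k = ket2 0 1 \/ k = ket2 1 0 ->
  forall a l, L a l k = 0.
Proof.
move=> kE a l; rewrite difference_jump_diag real_diagE.
have [->|//] := eqVneq l k.
by have [_ d01 d10 _] := jump_diagE; case: kE => ->; rewrite (d01, d10).
Qed.

Lemma dotp_difference v : dotp (difference_target R) v = v 0 0 - v 0 1.
Proof.
rewrite /dotp !big_ord_recl big_ord0 addr0.
rewrite (_ : lift ord0 ord0 = 1); last exact: val_inj.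
by rewrite !mxE /=; ring.
Qed.

Lemma generator_difference_diag v a b :
  generator g v (ket2 a b) (ket2 a b)
    = (v 0 0 * spin R a + v 0 1 * spin R b)%:C.
Proof. by rewrite generator_pauliZ2 real_diagE eqxx !bits_ket2. Qed.

Lemma difference_hnls : functional_hnls g L (difference_target R).
Proof.
move=> v /(lindblad_span_diag_eq dark_diag_eq dark_mul_diag_eq).
rewrite !generator_difference_diag dotp_difference /spin /= => /complexI.
by lra.
Qed.

Lemma hpart_difference_jump a : hpart (L a) = real_diag jump_diag.
Proof. by rewrite hpart_herm difference_jump_diag // adjoint_real_diag. Qed.

(** The sum of the two generators is a multiple of the jump itself, hence in the span, yet it has
    coefficient 1 on each parameter. *)
Lemma difference_not_hnls i : ~ functional_hnls g L (single_param R i).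
Proof.
move=> /(_ (const_mx 1)); rewrite dotp_single mxE => h.
suff /h /eqP : lindblad_span L (generator g (const_mx 1)).
  by rewrite oner_eq0.
have -> : generator g (const_mx 1)
    = (Num.sqrt gamma)^-1%:C *: hpart (L 0).
  rewrite generator_pauliZ2 hpart_difference_jump real_diagZ.
  congr real_diag; apply/funext => k; rewrite !mxE /jump_diag.
  by field; exact: (sqrtr_neq0 gamma_gt0).
exact: lindblad_span_hpart.
Qed.

Lemma zeta_star_difference : zeta_star g L (difference_target R) = 2.
Proof.
apply: (zeta_star_eq (z := fun=> 2) (beta0 := single_param R 0)) => //.
  move=> beta; rewrite dotp_difference => beta1; split; last first.
    move=> S LS; have := spread_generator_sub_ge beta
      (@adjoint_on_qubit_pauliZ R 2) dark_diag_eq dark_mul_diag_eq LS.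
    rewrite !generator_difference_diag /spin /=; apply: le_trans; lra.
  (* Chosen so that the multiple of the jump removes the symmetric part of [beta]; half the
     difference of the two spins is left, with values 0, 1 and -1. *)
  pose s := (beta 0 0 + beta 0 1) / 2 / Num.sqrt gamma.
  exists (s%:C *: hpart (L 0)); first exact: lindblad_span_hpart.
  rewrite generator_pauliZ2 hpart_difference_jump.
  rewrite real_diagZ real_diagN real_diagD.
  rewrite [X in real_diag X](_ : _
    = fun k => (spin R (bits k 0) - spin R (bits k 1)) / 2); last first.
    apply/funext => k; rewrite /jump_diag /s.
    rewrite mulrA divfK ?(sqrtr_neq0 gamma_gt0) //.
    by rewrite (_ : beta 0 0 = 1 + beta 0 1); [field|rewrite -beta1; ring].
  rewrite (spread_real_diag (i := ket2 0 1) (j := ket2 1 0)).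
    by rewrite !bits_ket2 /spin /=; field.
  move=> k; rewrite !bits_ket2 /spin /=.
  by apply/andP; do 2 case: ifP => _; split; lra.
by rewrite dotp_difference !mxE /=; ring.
Qed.

Lemma inv_Gamma_star_difference i :
  inv_Gamma_star g L (single_param R i) = 4 * (4 * gamma)^-1.
Proof.
have sg2 : Num.sqrt gamma ^+ 2 = gamma by rewrite sqr_sqrtr // ltW.
apply: (inv_Gamma_star_eq (k := ket2 0 1)).
- by apply: dark_state; left.
- move=> beta h0 h hh adm; rewrite big_ord_recl big_ord0 addr0.
  have := admissible_dark (ket2 0 1) (dark_state (or_introl erefl)) adm.
  have := admissible_dark (ket2 1 0) (dark_state (or_intror erefl)) adm.
  rewrite !generator_difference_diag !eqxx !big_ord_recl !big_ord0 !addr0.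
  rewrite !(dark_state (or_intror erefl)) !(dark_state (or_introl erefl)).
  rewrite !mulr0 !addr0 !mulr1n -!rmorphD => /complexI e10 /complexI e01.
  rewrite /spin /= in e10 e01.
  have [d1 _ E] := adm; rewrite dotp_single in d1.
  (* Adding and subtracting the two dark entries gives [h0 = 0] and equal coefficients; [d1] sets
     one of them to 1. *)
  have beta1 : beta 0 0 = 1 /\ beta 0 1 = 1.
    by case: (ord2_cases i) d1 => ->; split; lra.
  have diagE a b : spin R a + spin R b + h0
      + 2 * complex.Re (h 0) * jump_diag (ket2 a b)
      + complex.Re (hh 0 0) * jump_diag (ket2 a b) ^+ 2 = 0.
    move/matrixP: E => /(_ (ket2 a b) (ket2 a b)) /(congr1 (@complex.Re R)).
    rewrite !big_ord_recl !big_ord0 !addr0 difference_jump_diag.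
    rewrite adjoint_real_diag real_diagM -scalerDl generator_pauliZ2.
    rewrite !mxE !eqxx !mulr1n !bits_ket2 mulr1 !complexReD.
    rewrite ![_ * _%:C]mulrC !complexRe_real complexReD complexRe_conj.
    case: beta1 => -> ->; rewrite !mul1r => E'; apply: etrans E'.
    by rewrite [h ord0](_ : _ = h 0) //=; ring.
  (* The jump takes opposite values on the two parallel states, so subtracting these equations
     eliminates [h0] and the quadratic term and fixes the real part of [h 0]. *)
  have := diagE 0 0; have := diagE 1 1; rewrite /=.
  have [-> _ _ ->] := jump_diagE; rewrite /spin /= => e1 e2.
  have hE : Num.sqrt gamma * complex.Re (h 0) = - 2^-1 by lra.
  apply: le_trans (_ : complex.Re (h 0) ^+ 2 <= _); last first.
    rewrite -[leLHS]real_normK ?num_real // lerXn2r ?nnegrE ?normr_ge0 //.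
      exact: normc_ge0.
    exact: normc_ge_abs_Re.
  rewrite -(ler_pM2l gamma_gt0) -[X in _ <= X * _]sg2 -exprMn hE.
  rewrite invfM mulrCA divff ?gt_eqF // mulr1; lra.
(* The equality case: this real [h] makes the linear jump terms cancel the sum of the two
   generators. *)
exists (const_mx 1), 0, (fun=> - (2 * Num.sqrt gamma)^-1%:C); split.
  split; first by rewrite dotp_single mxE.
    by rewrite /adjoint map_mx0 trmx0.
  rewrite !big_ord_recl !big_ord0 !addr0 mxE scale0r scale0r !addr0.
  rewrite difference_jump_diag adjoint_real_diag -scalerDl -rmorphN conjC_real.
  rewrite -rmorphD real_diagZ generator_pauliZ2 real_diagD.
  apply/matrixP => k l; rewrite real_diagE !mxE /jump_diag.
  rewrite [X in X%:C](_ : _ = 0) ?mul0rn //.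
  by field; exact: (sqrtr_neq0 gamma_gt0).
rewrite big_ord_recl big_ord0 addr0 -rmorphN normc_real real_normK ?num_real //.
by rewrite sqrrN exprVn exprMn sg2; congr (_^-1); ring.
Qed.

Lemma eta_difference t : 0 < t ->
  eta g L t (difference_target R) = Num.sqrt (8 * gamma * t).
Proof.
move=> t0; rewrite /eta; congr Num.sqrt.
have Fi i : F_opt g L t (single_param R i) = t * (4 * (4 * gamma)^-1).
  rewrite /F_opt asboolF ?inv_Gamma_star_difference //.
  exact: difference_not_hnls.
rewrite [F_opt _ _ _ (difference_target R)]/F_opt asboolT; last first.
  exact: difference_hnls.
(* Two terms gamma / t from the single parameters are multiplied by 4 t^2 for the difference. *)
rewrite zeta_star_difference big_mkcond !big_ord_recl big_ord0 !Fi.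
rewrite !mxE /= subr0 sub0r oppr_eq0 oner_eq0 /=.
by field; rewrite !gt_eqF.
Qed.

End Difference.

(** * Fourier mode *)

(** Expands the squared length of the residual of [x] after projection onto [y]. *)
Lemma cauchy_schwarz_sum (R : realType) (I : finType) (x y : I -> R) (s : R) :
    \sum_i x i * y i = s -> 0 < \sum_i y i ^+ 2 ->
  s ^+ 2 / (\sum_i y i ^+ 2) <= \sum_i x i ^+ 2.
Proof.
set N := \sum_i y i ^+ 2 => xy N0.
have : 0 <= \sum_i (x i - s / N * y i) ^+ 2.
  by apply: sumr_ge0 => i _; exact: sqr_ge0.
have -> : \sum_i (x i - s / N * y i) ^+ 2
    = \sum_i x i ^+ 2 - 2 * (s / N) * (\sum_i x i * y i) + (s / N) ^+ 2 * N.
  by rewrite !mulr_sumr -sumrB -big_split; apply: eq_bigr => i _ /=; ring.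
rewrite xy.
have -> : (s / N) ^+ 2 * N = s ^+ 2 / N by field; rewrite gt_eqF.
have -> : 2 * (s / N) * s = 2 * (s ^+ 2 / N) by field; rewrite gt_eqF.
by lra.
Qed.

Lemma sum_delta (R : realType) (I : finType) (F : I -> R) i :
  \sum_j F j * (i == j)%:R = F i.
Proof.
rewrite (bigD1 i) //= big1 => [|j ji]; first by rewrite eqxx mulr1 addr0.
by rewrite eq_sym (negbTE ji) mulr0.
Qed.

Section Fourier.
Variables (R : realType) (m : nat) (gamma : R).
Hypothesis gamma_gt0 : 0 < gamma.
Implicit Types (alpha beta : 'rV[R]_m) (i j : 'I_m).
Local Notation g := (on_qubit (pauliX R)).
Local Notation L := (fourier_jump (m := m) gamma).

(** The dark state of the Fourier noise. Its matrix elements with the single excitations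
    [ket_flip j] read off the coefficient of the signal on qubit [j]. *)
Definition ket0 : 'I_(qdim m) := ket [ffun=> 0].
Definition ket_flip j : 'I_(qdim m) := ket [ffun i => if i == j then 1 else 0].

Lemma bits_ket0 i : bits ket0 i = 0.
Proof. by rewrite ketK ffunE. Qed.

Lemma bits_ket_flip i j : bits (ket_flip j) i = if i == j then 1 else 0.
Proof. by rewrite ketK ffunE. Qed.

Lemma sigma_minus_col0 b : sigma_minus R b 0 = 0.
Proof. by rewrite mxE andbF. Qed.

Lemma fourier_jump_dark a k : L a k ket0 = 0.
Proof.
have s0 i : on_qubit (sigma_minus R) i k ket0 = 0.
  by rewrite on_qubit_eq0 // bits_ket0 sigma_minus_col0.
by rewrite mxE [X in _ * X]mxE [X in _ + X]mxE !s0 subr0 mulr0.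
Qed.

Lemma on_qubit_flip (a : 'M[R[i]]_2) i j :
  on_qubit a i ket0 (ket_flip j) = a 0 1 *+ (i == j).
Proof.
have [->|ij] := eqVneq i j.
  rewrite on_qubit_local ?bits_ket0 ?bits_ket_flip ?eqxx // => j' /negbTE jj'.
  by rewrite bits_ket0 bits_ket_flip jj'.
by rewrite (@on_qubit_off _ _ _ _ j) 1?eq_sym // bits_ket0 bits_ket_flip eqxx.
Qed.

Lemma fourier_jump_flip a j : L a ket0 (ket_flip j)
  = (Num.sqrt gamma * ((a == j)%:R - (ordS a == j)%:R))%:C.
Proof.
rewrite mxE [X in _ * X]mxE [X in _ + X]mxE !on_qubit_flip mxE !eqxx /=.
by rewrite rmorphM rmorphB !rmorph_nat.
Qed.

Lemma generator_pauliX_flip beta j :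
  generator g beta ket0 (ket_flip j) = (beta 0 j)%:C.
Proof.
rewrite summxE (bigD1 j) //= big1 => [|i ij].
  by rewrite mxE on_qubit_flip eqxx !mxE !eqxx /= addr0 addr0 mulr1.
by rewrite mxE on_qubit_flip (negbTE ij) mulr0.
Qed.

Lemma ket0_neq_flip j : (ket0 == ket_flip j) = false.
Proof.
apply/eqP => /(congr1 (fun k => bits k j)).
by rewrite bits_ket0 bits_ket_flip eqxx.
Qed.

(** The operator D of the formula F = 4 t / (gamma |D alpha|^2). *)
Definition cyclic_diff alpha i : R := alpha 0 (ordS i) - alpha 0 i.

Lemma sum_shift (F G : 'I_m -> R) :
  \sum_j F j * G (ord_pred j) = \sum_j F (ordS j) * G j.
Proof.
rewrite (reindex_inj (@ordS_inj m)).
by apply: eq_bigr => j _; rewrite ordSK.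
Qed.

(** The dark row expresses [beta] through the differences of the real parts of [h]; pairing with
    [alpha] and summing by parts on the cycle moves the difference onto [alpha]. *)
Lemma fourier_constraint alpha beta h0 h hh :
    admissible g L alpha beta h0 h hh ->
  Num.sqrt gamma * (\sum_a complex.Re (h a) * cyclic_diff alpha a) = 1.
Proof.
move=> adm; have [<- _ _] := adm.
have betaE j : beta 0 j = \sum_a Num.sqrt gamma * complex.Re (h a)
    * ((ordS a == j)%:R - (a == j)%:R).
  have := admissible_dark (ket_flip j) (fun b n => fourier_jump_dark b n) adm.
  rewrite generator_pauliX_flip ket0_neq_flip addr0.
  move=> /(congr1 (@complex.Re R)).
  rewrite complexReD complexRe_sum => /eqP; rewrite addr_eq0 => /eqP /= ->.
  rewrite -sumrN; apply: eq_bigr => a _.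
  rewrite fourier_jump_flip mulrC complexRe_real complexRe_conj; ring.
rewrite /dotp; under [RHS]eq_bigr do rewrite betaE mulr_sumr.
rewrite exchange_big mulr_sumr; apply: eq_bigr => a _ /=.
transitivity (Num.sqrt gamma * complex.Re (h a)
  * (\sum_j alpha 0 j * (ordS a == j)%:R - \sum_j alpha 0 j * (a == j)%:R)).
  by rewrite !sum_delta mulrA.
rewrite -sumrB mulr_sumr; apply: eq_bigr => j _; ring.
Qed.

Lemma fourier_jump_herm a :
  L a + adjoint (L a) = (Num.sqrt gamma)%:C *: (g a - g (ordS a)).
Proof.
rewrite /fourier_jump adjointZ conjC_real adjointD adjointN -scalerDr.
rewrite !adjoint_on_qubit pauliX_sigma !on_qubitD; congr (_ *: _).
by rewrite opprD addrACA.
Qed.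

(** The Hermitian part of each jump is proportional to a difference of neighbouring generators, so
    the condition would make every cyclic difference of [alpha] vanish. *)
Lemma fourier_not_hnls alpha : 0 < \sum_a cyclic_diff alpha a ^+ 2 ->
  ~ functional_hnls g L alpha.
Proof.
move=> N0 hnls.
suff diffE a : cyclic_diff alpha a = 0.
  by move: N0; rewrite big1 ?ltxx // => a _; rewrite diffE expr0n.
pose v : 'rV[R]_m := single_param R (ordS a) - single_param R a.
have dotE : dotp alpha v = cyclic_diff alpha a.
  rewrite /dotp /v /cyclic_diff -(sum_delta (alpha 0) a).
  rewrite -(sum_delta (alpha 0) (ordS a)).
  rewrite -sumrB; apply: eq_bigr => j _.
  by rewrite !mxE !eqxx /= -mulrBr ![j == _]eq_sym.
rewrite -dotE; apply: hnls.
have gE i : generator g (single_param R i) = g i.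
  rewrite /generator (bigD1 i) //= big1 => [|j ji].
    by rewrite mxE !eqxx scale1r addr0.
  by rewrite mxE (negbTE ji) andbF scale0r.
(* The factor undoes the half in [hpart] and the rate in the jump; the sign appears because [v] is
   oriented from [a] to its successor. *)
have -> : generator g v = (- (2 / Num.sqrt gamma))%:C *: hpart (L a).
  rewrite /hpart fourier_jump_herm !scalerA.
  rewrite (_ : _ * _ = -1); last first.
    rewrite -(rmorph_nat (real_complex R) 2) -fmorphV -!rmorphM.
    rewrite -[RHS](rmorphN1 (real_complex R)).
    congr (_%:C); field; exact: (sqrtr_neq0 gamma_gt0).
  rewrite scaleN1r opprB -(gE (ordS a)) -(gE a) /generator -sumrB.
  by apply: eq_bigr => j _; rewrite -scalerBl -rmorphB !mxE.
exact: lindblad_span_hpart.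
Qed.

Lemma inv_Gamma_star_fourier alpha : 0 < \sum_a cyclic_diff alpha a ^+ 2 ->
  inv_Gamma_star g L alpha = 4 * (gamma * \sum_a cyclic_diff alpha a ^+ 2)^-1.
Proof.
set N := \sum_a _ => N0.
have sg2 : Num.sqrt gamma ^+ 2 = gamma by rewrite sqr_sqrtr // ltW.
have sg0 := (sqrtr_neq0 gamma_gt0).
apply: (inv_Gamma_star_eq (k := ket0)).
- by move=> b l; exact: fourier_jump_dark.
- move=> beta h0 h hh adm.
  apply: le_trans (_ : \sum_a complex.Re (h a) ^+ 2 <= _); last first.
    apply: ler_sum => a _; rewrite -[leLHS]real_normK ?num_real //.
    rewrite lerXn2r ?nnegrE ?normr_ge0 //; first exact: normc_ge0.
    exact: normc_ge_abs_Re.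
  have := cauchy_schwarz_sum (x := fun a => complex.Re (h a))
    (y := cyclic_diff alpha) (s := (Num.sqrt gamma)^-1).
  rewrite -/N exprVn sg2 invfM; apply => //.
  by apply: (mulfI sg0); rewrite (fourier_constraint adm) divff.
(* Equality in Cauchy-Schwarz: [x] is parallel to the cyclic difference of [alpha], normalised by
   [fourier_constraint]; [beta] is then forced by the constraint. *)
pose x a := cyclic_diff alpha a / (Num.sqrt gamma * N).
pose beta : 'rV[R]_m := \row_j (Num.sqrt gamma * (x (ord_pred j) - x j)).
exists beta, 0, (fun a => (x a)%:C); split; last first.
  under eq_bigr do rewrite normc_real real_normK ?num_real // expr_div_n.
  rewrite -mulr_suml -/N exprMn sg2; field.
  by rewrite !gt_eqF.
split; last 1 first.
- rewrite scale0r addr0 [X in _ + X]big1 => [|a _]; last first.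
    by rewrite big1 // => b _; rewrite mxE scale0r.
  rewrite addr0 (eq_bigr (fun a => (Num.sqrt gamma * x a)%:C *: g a
      - (Num.sqrt gamma * x a)%:C *: g (ordS a))); last first.
    move=> a _; rewrite conjC_real -scalerDr fourier_jump_herm.
    by rewrite scalerA -rmorphM mulrC scalerBr.
  have -> : generator g beta
      = \sum_j (Num.sqrt gamma * x (ord_pred j))%:C *: g j
        - \sum_j (Num.sqrt gamma * x j)%:C *: g j.
    rewrite -sumrB; apply: eq_bigr => j _.
    by rewrite mxE mulrBr rmorphB scalerBl.
  (* Shifting the first sum by one site turns the predecessor of [j] into [j], after which
     everything cancels. *)
  rewrite (reindex_inj (@ordS_inj m)) /= sumrB.
  under eq_bigr do rewrite ordSK.
  by rewrite addrA subrK subrr.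
- rewrite /dotp (eq_bigr (fun j => Num.sqrt gamma *
    (alpha 0 j * x (ord_pred j) - alpha 0 j * x j))) => [|j _]; last first.
    by rewrite mxE; ring.
  rewrite -mulr_sumr sumrB sum_shift -sumrB.
  rewrite (eq_bigr (fun j =>
    (Num.sqrt gamma * N)^-1 * cyclic_diff alpha j ^+ 2)).
    rewrite -mulr_sumr -/N; field; by rewrite gt_eqF.
  by move=> j _; rewrite /x /cyclic_diff; ring.
- by rewrite /adjoint map_mx0 trmx0.
Qed.

Lemma F_opt_fourier alpha t : 0 < \sum_a cyclic_diff alpha a ^+ 2 ->
  F_opt g L t alpha = t * (4 * (gamma * \sum_a cyclic_diff alpha a ^+ 2)^-1).
Proof.
move=> N0; rewrite /F_opt asboolF ?inv_Gamma_star_fourier //.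
exact: fourier_not_hnls.
Qed.

(** Only [j] and its predecessor contribute, with values -1 and 1; they are distinct because a cycle
    of length above 1 has no fixed point of [ordS]. *)
Lemma sum_cyclic_diff_single j : (1 < m)%N ->
  \sum_a cyclic_diff (single_param R j) a ^+ 2 = 2.
Proof.
move=> m1.
have SE (a : 'I_m) : (ordS a == a) = false.
  apply/eqP => /(congr1 val) /=.
  have [am|ma] := ltnP a.+1 m; first by rewrite modn_small // => /esym/n_Sn.
  have -> : a.+1 = m by apply/eqP; rewrite eqn_leq ma ltn_ord.
  by rewrite modnn => a0; rewrite -a0 leqNgt m1 in ma.
transitivity (\sum_a ((ordS a == j)%:R + (a == j)%:R : R)).
  apply: eq_bigr => a _; rewrite /cyclic_diff !mxE !eqxx /=.
  case: eqVneq => [<-|_]; first by rewrite eq_sym SE /= subr0 expr1n addr0.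
  by case: eqP => _; rewrite ?sub0r ?sqrrN ?expr1n ?expr0n add0r.
have shiftE : \sum_a (ordS a == j)%:R = \sum_a (a == j)%:R :> R.
  by rewrite [RHS](reindex_inj (@ordS_inj m)).
rewrite big_split /= shiftE.
rewrite (bigD1 j) //= big1 => [|a /negbTE -> //].
by rewrite eqxx addr0.
Qed.

End Fourier.

(** * The cosine mode under the cyclic difference *)

Section FourierMode.
Variables (R : realType) (m : nat).
Implicit Types (i j : 'I_m).

Let w : R := 2 * pi / m%:R.

Lemma fourier_targetE j : fourier_target R m 0 j = cos (w * j%:R).
Proof. by rewrite mxE /w; congr cos; ring. Qed.

(** The wrap-around at the last site is absorbed by periodicity, as [m] steps of [w] make a full
    turn. The offset [x] allows a step backwards with [x = - w]. *)
Lemma cos_ordS j (x : R) :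
  cos (w * (ordS j)%:R + x) = cos (w * j%:R + w + x).
Proof.
rewrite /=; have [jm|mj] := ltnP j.+1 m.
  by rewrite modn_small // -natr1; congr cos; ring.
have jm : j.+1 = m by apply/eqP; rewrite eqn_leq mj ltn_ord.
have m0 : m%:R != 0 :> R by rewrite pnatr_eq0 -jm.
have -> : w * j%:R + w = pi *+ 2.
  by rewrite -{2}[w]mulr1 -mulrDr natr1 jm /w divfK // mulr_natl.
by rewrite jm modnn mulr0 add0r addrC cosD2pi.
Qed.

(** The mode satisfies a three-term recurrence with factor [2 * cos w]; multiplying by the middle
    term and summing gives its correlation with its shift. The total is 2 (1 - cos w) S, rewritten
    by the double-angle formula. *)
Lemma sum_sqr_cyclic_diff_fourier :
  \sum_j cyclic_diff (fourier_target R m) j ^+ 2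
    = 4 * sin (pi / m%:R) ^+ 2 * \sum_j fourier_target R m 0 j ^+ 2.
Proof.
set S := \sum_j fourier_target R m 0 j ^+ 2.
pose a (j : 'I_m) : R := fourier_target R m 0 j.
have shiftS : \sum_j a (ordS j) ^+ 2 = S.
  by rewrite /S [RHS](reindex_inj (@ordS_inj m)).
have shiftT : \sum_j a (ordS (ordS j)) * a (ordS j) = \sum_j a (ordS j) * a j.
  by rewrite [RHS](reindex_inj (@ordS_inj m)).
have recE j : a (ordS (ordS j)) + a j = 2 * cos w * a (ordS j).
  rewrite /a !fourier_targetE -[w * (ordS (ordS j))%:R]addr0 cos_ordS addr0.
  rewrite -[in X in _ + X](addrK w (w * j%:R)) -cos_ordS.
  by rewrite cosD cosB; ring.
have T2 : 2 * (\sum_j a (ordS j) * a j) = 2 * cos w * S.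
  rewrite -shiftS [RHS]mulr_sumr mulr_natl mulr2n -{1}shiftT.
  rewrite -big_split; apply: eq_bigr => j _ /=.
  by rewrite expr2 mulrA -recE; ring.
have -> : \sum_j cyclic_diff (fourier_target R m) j ^+ 2
    = \sum_j a (ordS j) ^+ 2 + S - 2 * \sum_j a (ordS j) * a j.
  rewrite mulr_sumr -big_split -sumrB; apply: eq_bigr => j _ /=.
  by rewrite /cyclic_diff -!/(a _); ring.
rewrite T2 shiftS (_ : w = pi / m%:R *+ 2) ?cos_mulr2n ?cos2sin2; first by ring.
by rewrite /w -[RHS]mulr_natl mulrA.
Qed.

Lemma sum_sqr_fourier_gt0 : (0 < m)%N ->
  0 < \sum_j fourier_target R m 0 j ^+ 2.
Proof.
move=> m0; rewrite (bigD1 (Ordinal m0)) //= ltr_pwDl //.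
  by rewrite fourier_targetE mulr0 cos0 expr1n.
by apply: sumr_ge0 => j _; exact: sqr_ge0.
Qed.

Lemma sin_pi_div_gt0 : (1 < m)%N -> 0 < sin (pi / m%:R) :> R.
Proof.
move=> m1; have m0 : 0 < m%:R :> R by rewrite ltr0n ltnW.
apply: sin_gt0_pi; rewrite divr_gt0 ?pi_gt0 //=.
by rewrite ltr_pdivrMr // ltr_pMr ?pi_gt0 // ltr1n.
Qed.

Lemma sum_cyclic_diff_fourier_gt0 : (1 < m)%N ->
  0 < \sum_j cyclic_diff (fourier_target R m) j ^+ 2.
Proof.
move=> m1; rewrite sum_sqr_cyclic_diff_fourier.
by rewrite !mulr_gt0 ?exprn_gt0 ?sin_pi_div_gt0 ?sum_sqr_fourier_gt0 // ltnW.
Qed.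

(** Every single parameter has information 2 t / gamma, so the sum of squares of the target factors
    out of the sum and cancels against the same factor in the information for the mode. *)
Lemma fourier_etaE (gamma t : R) : (1 < m)%N -> 0 < gamma -> 0 < t ->
  fourier_eta m gamma t = 1 / (Num.sqrt 2 * sin (pi / m%:R)).
Proof.
move=> m1 gamma0 t0; rewrite /fourier_eta /eta.
have N0 := sum_cyclic_diff_fourier_gt0 m1.
have s0 := sin_pi_div_gt0 m1.
have S0 := sum_sqr_fourier_gt0 (ltnW m1).
have Fi i : F_opt (on_qubit (pauliX R)) (fourier_jump gamma) t
    (single_param R i) = t * (4 * (gamma * 2)^-1).
  by rewrite F_opt_fourier ?sum_cyclic_diff_single.
rewrite (F_opt_fourier gamma0 _ N0) sum_sqr_cyclic_diff_fourier.
set S := \sum_j _ in S0 *; set s := sin _ in s0 *.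
(* Terms excluded by the filter are zero, so the sum may run over all sites. *)
have -> : \sum_(i | fourier_target R m 0 i != 0) fourier_target R m 0 i ^+ 2
    / F_opt (on_qubit (pauliX R)) (fourier_jump gamma) t (single_param R i)
    = S / (t * (4 * (gamma * 2)^-1)).
  rewrite big_mkcond /S mulr_suml; apply: eq_bigr => i _; rewrite Fi.
  by case: eqP => // ->; rewrite expr0n mul0r.
transitivity (Num.sqrt ((Num.sqrt 2 * s) ^- 2)).
  congr Num.sqrt; rewrite exprMn sqr_sqrtr //.
  by field; rewrite !gt_eqF.
by rewrite -exprVn sqrtr_sqr ger0_norm ?div1r // invr_ge0 mulr_ge0 // ltW.
Qed.

End FourierMode.

(** * Asymptotics in the number of qubits *)

Lemma cvg_sin_div (R : realType) :
  (fun n : nat => sin (pi / n.+1%:R) / (pi / n.+1%:R)) @ \oo --> (1 : R).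
Proof.
(* The quotient is the difference quotient of [sin] at 0, taken along a nonvanishing null
   sequence. *)
have sinD0 : h^-1 *: (sin (h *: 1 + 0) - sin 0) @[h --> (0 : R)^'] --> (1 : R).
  have d0 : derivable sin (0 : R) 1 by exact: derivable_sin.
  have v0 : 'D_1 sin (0 : R) = 1 by rewrite derive_val cos0.
  by rewrite -[X in _ --> X]v0; exact: d0.
have u0 : (fun n : nat => pi / n.+1%:R) @ \oo --> (0 : R).
  rewrite -(mulr0 pi); apply: cvgMl_tmp; exact: cvg_harmonic.
have un n : pi / n.+1%:R != 0 :> R.
  by rewrite mulf_neq0 ?invr_eq0 ?pnatr_eq0 // gt_eqF ?pi_gt0.
have := (cvgr_dnbhsP _ _ _).1 sinD0 (fun n => pi / n.+1%:R) (conj un u0).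
apply: cvg_trans; apply: near_eq_cvg; near=> n.
by rewrite scaler1 addr0 sin0 subr0 /GRing.scale /= mulrC.
Unshelve. all: by end_near.
Qed.

Lemma fourier_eta_equiv (R : realType) (gamma t : R) : 0 < gamma -> 0 < t ->
  (fun m : nat => fourier_eta m gamma t)
    ~_\oo (fun m : nat => m%:R / (Num.sqrt 2 * pi)).
Proof.
move=> gamma0 t0; apply/eqaddoP => e e0.
have inv_cvg : (fun n : nat => (sin (pi / n%:R) / (pi / n%:R))^-1) @ \oo
    --> (1 : R).
  rewrite -cvg_shiftS.
  have : (fun n => (sin (pi / n.+1%:R) / (pi / n.+1%:R))^-1) @ \oo
    --> (1 : R)^-1 by apply: cvgV; [exact: oner_neq0 | exact: cvg_sin_div].
  by rewrite invr1; apply.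
have /cvgrPdist_le/(_ e e0) := inv_cvg; rewrite near_simpl => near1.
near=> n.
(* The closed form is available from two qubits on, hence eventually. *)
have n1 : (1 < n)%N by near: n; exact: nbhs_infty_gt.
rewrite [X in `|X| <= _](_ : _
  = fourier_eta n gamma t - n%:R / (Num.sqrt 2 * pi)) // fourier_etaE //.
have s0 := @sin_pi_div_gt0 R _ n1.
have n0 : 0 < n%:R :> R by rewrite ltr0n ltnW.
(* Factors out the claimed equivalent; the relative error is the distance of [inv_cvg]'s sequence
   from its limit 1. *)
have -> : 1 / (Num.sqrt 2 * sin (pi / n%:R)) - n%:R / (Num.sqrt 2 * pi)
    = - (1 - (sin (pi / n%:R) / (pi / n%:R))^-1) * (n%:R / (Num.sqrt 2 * pi))
    :> R.
  move: (sin _) s0 => s s0; move: (@pi R) (pi_gt0 R) => p p0.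
  by field; rewrite !gt_eqF ?sqrtr_gt0.
rewrite normrM normrN ler_wpM2r ?normr_ge0 //.
by near: n; exact: near1.
Unshelve. all: by end_near.
Qed.

Theorem mainTheorem4 (R : realType) :
  (* (a) average *)
  (forall (m : nat) (gamma : 'I_m -> R) (t : R),
      (1 <= m)%N -> (forall i, 0 < gamma i) -> 0 < t ->
      let g := on_qubit (pauliZ R) in
      let L := average_jump gamma in
      [/\ functional_hnls g L (average_target R m),
          (forall i, functional_hnls g L (single_param R i)) &
          eta g L t (average_target R m) = Num.sqrt m%:R])
  /\
  (* (b) difference *)
  (forall gamma t : R,
      0 < gamma -> 0 < t ->
      let g := on_qubit (m := 2) (pauliZ R) in
      let L := difference_jump gamma in
      [/\ functional_hnls g L (difference_target R),
          ~ functional_hnls g L (single_param R 0),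
          ~ functional_hnls g L (single_param R 1) &
          eta g L t (difference_target R) = Num.sqrt (8 * gamma * t)])
  /\
  (* (c) Fourier mode *)
  (forall (m : nat) (gamma t : R),
      (3 <= m)%N -> 0 < gamma -> 0 < t ->
      let g := on_qubit (pauliX R) in
      let L := fourier_jump (m := m) gamma in
      [/\ ~ functional_hnls g L (fourier_target R m),
          (forall j, ~ functional_hnls g L (single_param R j)) &
          eta g L t (fourier_target R m)
            = 1 / (Num.sqrt 2 * sin (pi / m%:R))])
  /\
  (forall gamma t : R, 0 < gamma -> 0 < t ->
      (fun m : nat => fourier_eta m gamma t)
        ~_\oo (fun m : nat => m%:R / (Num.sqrt 2 * pi))).
Proof.
split.
  move=> m gamma t m0 _ t0; split=> [|i|]; first exact: average_hnls.
    exact: average_hnls.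
  exact: eta_average.
split.
  move=> gamma t gamma0 t0; split; first exact: difference_hnls.
  - exact: difference_not_hnls.
  - exact: difference_not_hnls.
  - exact: eta_difference.
split; last by move=> gamma t; exact: fourier_eta_equiv.
move=> m gamma t m3 gamma0 t0; have m1 : (1 < m)%N := ltnW m3.
split; last exact: fourier_etaE.
  by apply: fourier_not_hnls => //; exact: sum_cyclic_diff_fourier_gt0.
by move=> j; apply: fourier_not_hnls; rewrite // sum_cyclic_diff_single.
Qed.
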